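(* Let $G$ and $G'$ be graphs on the vertex set $\{1,\dots,n\}$ with adjacency matrices $\Gamma$ and $\Gamma'$ over $\mathbb{F}_2$. Then $G$ and $G'$ are edge-locally equivalent if and only if there exists a diagonal $n\times n$ matrix $A$ over $\mathbb{F}_2$ such that $$(\Gamma'+I)A(\Gamma+I)=\Gamma+\Gamma'.$$ This is a system of $n^2$ affine equations over $\mathbb{F}_2$ in the $n$ diagonal entries of $A$; consequently, edge-local equivalence of two given graphs on $n$ vertices can be decided in $O(n^4)$ time (arithmetic operations in $\mathbb{F}_2$).
   Context: All matrices are over $\mathbb{F}_2$. Graphs are finite, undirected and simple with vertex set $V=\{1,\dots,n\}$; adjacency matrices are symmetric over $\mathbb{F}_2$ with zero diagonal. Local complementation: for a vertex $i$, $G*i$ is the graph on $V$ obtained from $G$ by replacing the subgraph induced on the neighborhood $N(i)$ by its complement and leaving the rest unchanged. For an edge $e=\{i,j\}$ of $G$, the edge-local complement is $G*e=((G*i)*j)*i=((G*j)*i)*j$. Two graphs $G,G'$ on $V$ are edge-locally equivalent if there is a finite (possibly empty) sequence $e_1,\dots,e_N$ of 2-element subsets of $V$ such that $e_1$ is an edge of $G$, $e_\alpha$ is an edge of $((G*e_1)*\dots)*e_{\alpha-1}$ for $\alpha=2,\dots,N$, and $((G*e_1)*\dots)*e_N=G'$. *)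

(* Defs.v *)
From HB Require Import structures.
From mathcomp Require Import all_boot all_order all_algebra.

Set Implicit Arguments.
Unset Strict Implicit.
Unset Printing Implicit Defensive.

Import GRing.Theory.

(* A finite simple graph on 'I_n is its set of edges, i.e. of 2-element vertex
   sets; with this representation equality of graphs is Leibniz equality. *)
Record graph (n : nat) := Graph {
  edges : {set {set 'I_n}};
  edgesP : [forall e in edges, #|e| == 2]
}.

HB.instance Definition _ (n : nat) := [isSub for @edges n].

Definition adj n (G : graph n) (i j : 'I_n) : bool := [set i; j] \in edges G.

Definition nbhd n (G : graph n) (i : 'I_n) : {set 'I_n} := [set j | adj G i j].

Definition adjmx n (G : graph n) : 'M['F_2]_n :=
  (\matrix_(i, j) (adj G i j)%:R)%R.

(* Symmetric difference with the complete graph on N(i). *)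
Definition lc_edges n (G : graph n) (i : 'I_n) : {set {set 'I_n}} :=
  [set e | (e \in edges G) (+) ((#|e| == 2) && (e \subset nbhd G i))].

Lemma lc_edgesP n (G : graph n) (i : 'I_n) :
  [forall e in lc_edges G i, #|e| == 2].
Proof.
apply/forall_inP => e; rewrite inE.
by case: eqP => //= ne2; rewrite addbF => /(forall_inP (edgesP G)) /eqP.
Qed.

Definition local_compl n (G : graph n) (i : 'I_n) : graph n :=
  Graph (lc_edgesP G i).

(* The edge {i, j} is given by either of the ordered pairs (i, j), (j, i);
   edge_local_complC below shows that the choice is immaterial on edges. *)
Definition edge_local_compl n (G : graph n) (e : 'I_n * 'I_n) : graph n :=
  local_compl (local_compl (local_compl G e.1) e.2) e.1.

Fixpoint edge_sequence n (G : graph n) (s : seq ('I_n * 'I_n)) : bool :=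
  if s is e :: s' then
    adj G e.1 e.2 && edge_sequence (edge_local_compl G e) s'
  else true.

Definition edge_locally_equivalent n (G G' : graph n) : Prop :=
  exists s : seq ('I_n * 'I_n),
    edge_sequence G s /\ foldl (@edge_local_compl n) G s = G'.

Lemma adjC n (G : graph n) i j : adj G i j = adj G j i.
Proof. by rewrite /adj setUC. Qed.

Lemma adjii n (G : graph n) i : adj G i i = false.
Proof.
apply/negP => /(forall_inP (edgesP G)); by rewrite setUid cards1.
Qed.

Lemma adj_local_compl n (G : graph n) i x y :
  adj (local_compl G i) x y = adj G x y (+) [&& x != y, adj G i x & adj G i y].
Proof.
rewrite {1}/adj inE cards2 subUset !sub1set !inE.
by case: (x == y).
Qed.

Lemma graph_eqP n (G G' : graph n) : adj G =2 adj G' -> G = G'.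
Proof.
move=> eqG; apply: val_inj; apply/setP => e /=.
have [/cards2P [x [y [_ ->]]]|ne2] := boolP (#|e| == 2); first exact: eqG.
have out (H : graph n) : e \notin edges H.
  by apply: contra ne2 => eH; apply: (forall_inP (edgesP H)).
by rewrite !(negbTE (out _)).
Qed.

Lemma edge_local_complC n (G : graph n) i j :
  adj G i j -> edge_local_compl G (i, j) = edge_local_compl G (j, i).
Proof.
move=> ij; apply: graph_eqP => x y; rewrite /edge_local_compl /=.
rewrite !adj_local_compl !adjii !(adjC G j i) !ij.
case: (eqVneq x y) => [->|xy] /=; first by rewrite !addbF.
have nij : i != j by apply/eqP => e; rewrite e adjii in ij.
rewrite (eq_sym j i) nij /=.
case: (eqVneq i x) => [?|ix]; case: (eqVneq j x) => [?|jx];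
case: (eqVneq i y) => [?|iy]; case: (eqVneq j y) => [?|jy]; subst => //=;
  rewrite ?eqxx ?ij ?(adjC G _ i) ?(adjC G _ j) ?ij ?adjii //= in nij xy *;
  by rewrite ?(adjC G y x); do ?case: (adj _ _ _).
Qed.

(* A uniform random-access machine over F_2: finitely many index registers
   holding natural numbers, finitely many two-dimensional arrays over F_2,
   and structured programs, with bounded loops only.  An array name is a
   constant of the program; array subscripts are contents of registers.
   Registers can only be set to constants, copied, incremented and compared,
   so that no register exceeds n plus a constant (depending on the program) plus
   the running time. *)
Record cell := Cell { cell_arr : nat; cell_row : nat; cell_col : nat }.

Inductive cmd : Type :=
| Skip
| Seq of cmd & cmd
| IConst of nat & nat                  (* x := k *)
| ICopy of nat & nat                   (* x := y *)
| IIncr of nat                         (* x := x + 1 *)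
| FConst of cell & 'F_2                (* u := b *)
| FAdd of cell & cell & cell           (* u := v + w *)
| FMul of cell & cell & cell           (* u := v * w *)
| IfLt of nat & nat & cmd & cmd        (* if x < y then .. else .. *)
| IfZero of cell & cmd & cmd           (* if u = 0 then .. else .. *)
| For of nat & nat & cmd.              (* for x = 0, .., y - 1 do .. *)

Record state := State {
  reg : nat -> nat;
  mem : nat -> nat -> nat -> 'F_2
}.

Definition set_reg (s : state) (x k : nat) : state :=
  State (fun y => if y == x then k else reg s y) (mem s).

Definition get_cell (s : state) (u : cell) : 'F_2 :=
  mem s (cell_arr u) (reg s (cell_row u)) (reg s (cell_col u)).

Definition set_cell (s : state) (u : cell) (b : 'F_2) : state :=
  State (reg s) (fun a i j =>
    if [&& a == cell_arr u, i == reg s (cell_row u) & j == reg s (cell_col u)]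
    then b else mem s a i j).

(* Final state and running time.  Every instruction costs one unit, not only
   the arithmetic of F_2: conditionals and loops cost one unit in addition to
   their body, and each loop iteration one further unit.  The number of
   iterations of a loop is fixed on entry. *)
Fixpoint exec (c : cmd) (s : state) : state * nat :=
  match c with
  | Skip => (s, 1)
  | Seq c1 c2 =>
      let r1 := exec c1 s in let r2 := exec c2 r1.1 in (r2.1, r1.2 + r2.2)
  | IConst x k => (set_reg s x k, 1)
  | ICopy x y => (set_reg s x (reg s y), 1)
  | IIncr x => (set_reg s x (reg s x).+1, 1)
  | FConst u b => (set_cell s u b, 1)
  | FAdd u v w => (set_cell s u (get_cell s v + get_cell s w)%R, 1)
  | FMul u v w => (set_cell s u (get_cell s v * get_cell s w)%R, 1)
  | IfLt x y c1 c2 =>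
      let r := exec (if reg s x < reg s y then c1 else c2) s in (r.1, r.2.+1)
  | IfZero u c1 c2 =>
      let r := exec (if get_cell s u == 0%R then c1 else c2) s in (r.1, r.2.+1)
  | For x y c1 =>
      iteri (reg s y)
        (fun k acc =>
           let r := exec c1 (set_reg acc.1 x k) in (r.1, acc.2 + r.2.+1))
        (s, 1)
  end.

Definition mx_array n (M : 'M['F_2]_n) (i j : nat) : 'F_2 :=
  if insub i is Some i' then if insub j is Some j' then M i' j' else 0%R
  else 0%R.

(* Input: n in register 0, the two adjacency matrices in arrays 0 and 1;
   everything else is 0. *)
Definition input_state n (G G' : graph n) : state :=
  State (fun x => if x == 0 then n else 0)
        (fun a => if a == 0 then mx_array (adjmx G)
                  else if a == 1 then mx_array (adjmx G')
                  else fun _ _ => 0%R).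

(* Output: entry (0, 0) of array 2. *)
Definition accepts (c : cmd) n (G G' : graph n) : bool :=
  mem (exec c (input_state G G')).1 2 0 0 == 1%R.

Definition running_time (c : cmd) n (G G' : graph n) : nat :=
  (exec c (input_state G G')).2.

(* A single program decides the relation P for all n, in time O(f(n)). *)
Definition decidable_in_time (P : forall n, graph n -> graph n -> Prop)
    (f : nat -> nat) : Prop :=
  exists c : cmd,
    (forall n (G G' : graph n), accepts c G G' <-> P n G G') /\
    (exists C n0 : nat, forall n (G G' : graph n),
       n0 <= n -> running_time c G G' <= C * f n).

(* Main.v *)
Require Import Defs.
From HB Require Import structures.
From mathcomp Require Import all_boot all_order all_algebra zify.

Set Implicit Arguments.
Unset Strict Implicit.
Unset Printing Implicit Defensive.

Import GRing.Theory.
Local Open Scope ring_scope.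

(* Put N = Gamma + I and N' = Gamma' + I.  The equation N' A N = N - N' is a
   resolvent identity, so its solutions add up along a sequence of graphs, and
   edge-local complementation at {i, j} satisfies it with A the indicator of
   {i, j}.  Conversely, if A is the indicator of X and i is in X, then i has a
   neighbour j in X: otherwise the (i, i) entry of N' A N would be 1.
   Complementing G at {i, j} removes i and j from X, and X = 0 means G = G'.

   The linear system is solved by inserting its n^2 equations one at a time into
   an echelon basis with at most one row for each of the n pivots.  Reducing an
   equation of length n + 1 against the basis takes O(n^2) steps, which gives
   O(n^4) in total. *)

(** * Edge-local complementation and the matrix equation *)

Lemma F2_cases (x : 'F_2) : x = 0 \/ x = 1.
Proof.
by case: x => [[|[|m]] lt_m2] //; [left | right]; apply: val_inj.
Qed.

Lemma addrr_F2 (x : 'F_2) : x + x = 0.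
Proof. by case: (F2_cases x) => ->; apply: val_inj. Qed.

Lemma oppr_F2 (x : 'F_2) : - x = x.
Proof. by apply/eqP; rewrite eq_sym -addr_eq0 addrr_F2. Qed.

Lemma mulrr_F2 (x : 'F_2) : x * x = x.
Proof. by case: (F2_cases x) => ->; rewrite ?mulr0 ?mulr1. Qed.

Lemma addr_eq0_F2 (x y : 'F_2) : x + y = 0 <-> x = y.
Proof.
by split=> [/eqP|->]; rewrite ?addrr_F2 // addr_eq0 oppr_F2 => /eqP.
Qed.

Lemma natr_addb_F2 (a b : bool) : (a (+) b)%:R = a%:R + b%:R :> 'F_2.
Proof. by case: a; case: b; apply: val_inj. Qed.

Lemma natr_andb_F2 (a b : bool) : (a && b)%:R = a%:R * b%:R :> 'F_2.
Proof. by case: a; case: b; apply: val_inj. Qed.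

Lemma oppmx_F2 m n (A : 'M['F_2]_(m, n)) : - A = A.
Proof. by apply/matrixP=> i j; rewrite mxE oppr_F2. Qed.

Lemma addmxx_F2 m n (A : 'M['F_2]_(m, n)) : A + A = 0.
Proof. by apply/matrixP=> i j; rewrite !mxE addrr_F2. Qed.

(* The hypotheses are resolvent identities: they say N'^-1 = N^-1 + D and
   N''^-1 = N'^-1 + E, except that invertibility is not required. *)
Lemma resolvent_trans (R : pzRingType) n (N N' N'' D E : 'M[R]_n) :
  N' *m D *m N = N - N' -> N'' *m E *m N' = N' - N'' ->
  N'' *m (D + E) *m N = N - N''.
Proof.
move=> eD eE; have eN : N'' = N' - N'' *m E *m N' by rewrite eE subKr.
have -> : N'' *m (D + E) *m N = (N' - N'' *m E *m N') *m D *m N + N'' *m E *m N.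
  by rewrite -eN mulmxDr mulmxDl.
rewrite !mulmxBl -(mulmxA (N'' *m E) N') -(mulmxA (N'' *m E)) eD mulmxBr eE.
by rewrite opprB -addrA subrK addrA subrK.
Qed.

Definition loopmx n (G : graph n) : 'M['F_2]_n := adjmx G + 1%:M.

Definition pivot_eq n (G G' : graph n) (d : 'rV['F_2]_n) : Prop :=
  loopmx G' *m diag_mx d *m loopmx G = adjmx G + adjmx G'.

Section Pivot.
Variable n : nat.
Implicit Types (G : graph n) (d : 'rV['F_2]_n).

Lemma loopmxE G i j : loopmx G i j = (adj G i j (+) (i == j))%:R.
Proof. by rewrite !mxE natr_addb_F2. Qed.

Lemma loopmx_tr G : (loopmx G)^T = loopmx G.
Proof. by apply/matrixP=> i j; rewrite mxE !loopmxE adjC eq_sym. Qed.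

Lemma loopmxB G G' : loopmx G - loopmx G' = adjmx G + adjmx G'.
Proof. by rewrite oppmx_F2 addrACA addmxx_F2 addr0. Qed.

Lemma mul_diag_mulE (R : pzRingType) (M N : 'M[R]_n) (d : 'rV[R]_n) i j :
  (M *m diag_mx d *m N) i j = \sum_k M i k * d 0 k * N k j.
Proof. by rewrite mul_mx_diag mxE; apply: eq_bigr => k _; rewrite mxE. Qed.

(** The three factors and both adjacency matrices are symmetric, so transposition merely swaps the
    outer factors. *)
Lemma pivot_eq_sym G G' d : pivot_eq G G' d -> pivot_eq G' G d.
Proof.
move=> /(congr1 trmx); rewrite !trmx_mul tr_diag_mx !loopmx_tr mulmxA /pivot_eq.
move=> ->; rewrite addrC linearD /=.
by congr (_ + _); apply/matrixP=> i j; rewrite !mxE adjC.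
Qed.

Lemma pivot_eq_trans G1 G2 G3 d e :
  pivot_eq G1 G2 d -> pivot_eq G2 G3 e -> pivot_eq G1 G3 (d + e).
Proof.
rewrite /pivot_eq -!loopmxB (raddfD (@diag_mx _ n)); exact: resolvent_trans.
Qed.

Lemma pivot_eq0 G G' : pivot_eq G G' 0 <-> G = G'.
Proof.
rewrite /pivot_eq raddf0 mulmx0 mul0mx; split=> [e|->]; last first.
  by rewrite addmxx_F2.
apply: graph_eqP => i j; move/matrixP/(_ i j): e; rewrite !mxE.
by move=> /esym/addr_eq0_F2; do 2!case: (adj _ _ _).
Qed.

(** The sum for entry (x, y) keeps only the terms at [i] and [j]; what remains is a Boolean
    identity, checked by whether x and y lie in {i, j} and whether x = y. *)
Lemma pivot_eq_edge G i j :
  adj G i j -> pivot_eq G (edge_local_compl G (i, j))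
                        (delta_mx 0 i + delta_mx 0 j).
Proof.
move=> ij; have nij : i != j by apply/eqP => e; rewrite e adjii in ij.
apply/matrixP=> x y; rewrite mul_diag_mulE.
rewrite (bigD1 i) // (bigD1 j) ?(eq_sym j) //= big1 => [|k /andP[ki kj]].
  rewrite !mxE !eqxx !andTb !(eq_sym j i) (negbTE nij) !addr0 add0r.
  rewrite !mulr1 -!natr_addb_F2 -!natr_andb_F2 -!natr_addb_F2.
  congr (_%:R); congr nat_of_bool.
  rewrite /edge_local_compl /= !adj_local_compl !adjii !(adjC G j i) !ij.
  rewrite nij (eq_sym j i).
  rewrite !(adjC G x) (adjC G y) !(eq_sym j x) !(eq_sym j y).
  rewrite !(eq_sym i x) !(eq_sym i y).
  have nji : j != i by rewrite eq_sym.
  have [->|xi] := eqVneq x i; last have [->|xj] := eqVneq x j;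
  (have [->|yi] := eqVneq y i; last have [->|yj] := eqVneq y j);
  rewrite ?adjii ?ij ?(adjC G j i) ?ij ?eqxx ?(eq_sym i y) ?(eq_sym j y)
          ?(negbTE nij) ?(negbTE nji) ?(negbTE xi) ?(negbTE xj)
          ?(negbTE yi) ?(negbTE yj) /= ?andbF ?addbF //=;
  rewrite ?(adjC G x i) ?(adjC G x j); try by do ?case: (adj _ _ _).
  have [->|xy] := eqVneq x y; last by do ?case: (adj _ _ _).
  by rewrite ?adjii; do ?case: (adj _ _ _).
by rewrite !mxE !eqxx (negbTE ki) (negbTE kj) addr0 mulr0 mul0r.
Qed.

(* Otherwise the (i, i) entry of the left-hand side is 1, while the diagonal of
   the right-hand side vanishes. *)
Lemma pivot_eq_exists_edge G G' d i :
  pivot_eq G G' d -> d 0 i = 1 -> exists2 j, adj G i j & d 0 j = 1.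
Proof.
move=> e di.
have [/existsP[j /andP[ij /eqP dj]]|/existsPn noj] :=
  boolP [exists j, adj G i j && (d 0 j == 1)]; first by exists j.
move/matrixP/(_ i i): e; rewrite mul_diag_mulE (bigD1 i) //= big1 => [|k ki].
  by rewrite !loopmxE !mxE !adjii di eqxx.
rewrite (loopmxE G) (negbTE ki) addbF adjC.
have [->|dk] := F2_cases (d 0 k); first by rewrite mulr0 mul0r.
by have := noj k; rewrite dk eqxx andbT => /negbTE->; rewrite mulr0.
Qed.

Lemma edge_locally_equivalent_pivot G G' :
  edge_locally_equivalent G G' -> exists d, pivot_eq G G' d.
Proof.
case=> s; elim: s G => [|[i j] s IH] G /= [].
  by move=> _ ->; exists 0; apply/pivot_eq0.
move=> /andP[ij Gs] eG'; have [d ed] := IH _ (conj Gs eG').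
by eexists; apply: pivot_eq_trans (pivot_eq_edge ij) ed.
Qed.

Lemma pivot_edge_locally_equivalent G G' d :
  pivot_eq G G' d -> edge_locally_equivalent G G'.
Proof.
(* Induction on the size of the support of [d]. *)
have [m] := ubnP #|[set i | d 0 i == 1]|; elim: m G d => // m IH G d lt_m e.
have [d0|/set0Pn[i]] := eqVneq [set i | d 0 i == 1] set0.
  exists [::]; split=> //=; apply/pivot_eq0; suff <- : d = 0 by [].
  apply/rowP=> i; rewrite mxE; move/setP/(_ i): d0; rewrite !inE.
  by case: (F2_cases (d 0 i)) => ->.
rewrite inE => /eqP di; have [j ij dj] := pivot_eq_exists_edge e di.
have nij : i != j by apply/eqP => eij; rewrite eij adjii in ij.
(* Back along the edge from the complemented graph to [G], then on to [G']: the two diagonals add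
   up, and the entries at [i] and [j] become 1 + 1 = 0. *)
have e1 := pivot_eq_trans (pivot_eq_sym (pivot_eq_edge ij)) e.
have [|s [Gs es]] := IH _ _ _ e1; last by exists ((i, j) :: s); rewrite /= ij.
rewrite -ltnS; apply: leq_trans lt_m; rewrite ltnS; apply: proper_card.
apply/properP; split; last first.
  by exists i; rewrite inE ?di // !mxE !eqxx (negbTE nij) di.
apply/subsetP=> k; rewrite !inE !mxE /=.
have [->|_] := eqVneq k i; first by rewrite di.
have [->|_] := eqVneq k j; first by rewrite dj.
by rewrite !add0r.
Qed.

End Pivot.

Lemma edge_locally_equivalentP n (G G' : graph n) :
  edge_locally_equivalent G G' <-> exists d, pivot_eq G G' d.
Proof.
split=> [|[d]]; first exact: edge_locally_equivalent_pivot.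
exact: pivot_edge_locally_equivalent.
Qed.

Lemma pivot_eq_system n (G G' : graph n) (d : 'rV['F_2]_n) :
  pivot_eq G G' d <->
  forall i j : 'I_n,
    \sum_(k < n) (loopmx G' i k * loopmx G k j) * d 0 k =
    adjmx G i j + adjmx G' i j.
Proof.
have entryE i j : (loopmx G' *m diag_mx d *m loopmx G) i j =
                  \sum_(k < n) (loopmx G' i k * loopmx G k j) * d 0 k.
  by rewrite mul_diag_mulE; apply: eq_bigr => k _; rewrite mulrAC.
split=> [/matrixP e i j|e]; first by rewrite -entryE e mxE.
by apply/matrixP=> i j; rewrite entryE e [RHS]mxE.
Qed.

(** * Echelon systems over F_2 *)

(* Entry n of a row of the augmented matrix is the right-hand side. *)
Definition satisfies n (v d : nat -> 'F_2) : Prop := \sum_(k < n) v k * d k = v n.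

(** Rows are indexed by their pivots, and a zero row is a free slot. A zero row has right-hand side
    0 too, so the contradiction 0 = 1 is never stored. *)
Definition echelon n (B : nat -> nat -> 'F_2) : Prop :=
  forall p, (p < n)%N ->
    (B p p = 1 /\ forall q, (q < p)%N -> B p q = 0) \/
    (forall q, (q <= n)%N -> B p q = 0).

Section LinearSystems.
Variable n : nat.
Implicit Types v w d : nat -> 'F_2.

Lemma eq_satisfies v w d :
  (forall q, (q <= n)%N -> v q = w q) -> satisfies n v d <-> satisfies n w d.
Proof.
move=> vw; rewrite /satisfies (vw n) //.
by rewrite (eq_bigr (fun k : 'I_n => w k * d k)) // => k _; rewrite vw // ltnW.
Qed.

Lemma satisfies0 v d : (forall q, (q <= n)%N -> v q = 0) -> satisfies n v d.
Proof.
move=> v0; rewrite /satisfies v0 // big1 // => k _.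
by rewrite v0 ?mul0r // ltnW.
Qed.

Lemma satisfies_add v w u d :
  (forall q, (q <= n)%N -> u q = v q + w q) -> satisfies n w d ->
  satisfies n u d <-> satisfies n v d.
Proof.
move=> uE; rewrite (eq_satisfies _ uE) /satisfies => wd.
rewrite (eq_bigr (fun k : 'I_n => v k * d k + w k * d k)); last first.
  by move=> k _; rewrite mulrDl.
by rewrite big_split /= wd; split=> [/addIr|->].
Qed.

Lemma not_satisfies v d :
  (forall q, (q < n)%N -> v q = 0) -> v n = 1 -> ~ satisfies n v d.
Proof. by move=> v0 v1; rewrite /satisfies v1 big1 // => k _; rewrite v0 ?mul0r. Qed.

(* Back substitution: the unknowns are fixed from the last one down. *)
Lemma echelon_solvable B :
  echelon n B -> exists d, forall p, (p < n)%N -> satisfies n (B p) d.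
Proof.
move=> eB.
suff /(_ n (leqnn n))[d dP] : forall m, (m <= n)%N ->
    exists d, forall p, (n - m <= p < n)%N -> satisfies n (B p) d.
  by exists d => p pn; apply: dP; rewrite subnn.
elim=> [|m IH] mn; first by exists (fun=> 0) => p; lia.
have [d dP] := IH (ltnW mn).
set p := (n - m.+1)%N; have pn : (p < n)%N by rewrite /p; lia.
have [[Bpp _]|Bp0] := eB p pn; last first.
  exists d => q /andP[pq qn]; have [->|qp] := eqVneq q p; first exact: satisfies0.
  by apply: dP; lia.
pose op := Ordinal pn.
(* Row p solved for unknown p: its coefficient is 1, and signs vanish over F_2. *)
pose c := B p n + \sum_(k < n | k != op) B p k * d k.
exists (fun q => if q == p then c else d q) => q /andP[pq qn].
have sumE r : \sum_(k < n | k != op) B r k * (if (k : nat) == p then c else d k)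
            = \sum_(k < n | k != op) B r k * d k.
  apply: eq_bigr => k; rewrite -val_eqE /= => /negbTE-> //.
rewrite /satisfies (bigD1 op) //= sumE eqxx.
have [->|qp] := eqVneq q p.
  by rewrite Bpp mul1r /c -addrA addrr_F2 addr0.
have qm : (n - m <= q < n)%N by lia.
rewrite -(dP q qm) [RHS](bigD1 op) //=; congr (_ + _).
(* Rows after p have coefficient 0 at p, so the new value leaves them satisfied. *)
have [[_ Bq]|Bq] := eB q qn; rewrite Bq ?mul0r //; lia.
Qed.

End LinearSystems.

(** * Time-bounded Hoare triples *)

Local Open Scope nat_scope.

Definition triple (P : state -> Prop) (c : cmd) (t : nat) (Q : state -> Prop) :=
  forall s, P s -> Q (exec c s).1 /\ (exec c s).2 <= t.

Lemma triple_skip P : triple P Skip 1 P.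
Proof. by []. Qed.

Lemma triple_seq Q P R c1 c2 t1 t2 :
  triple P c1 t1 Q -> triple Q c2 t2 R -> triple P (Seq c1 c2) (t1 + t2) R.
Proof.
move=> h1 h2 s /h1[/h2[Rs le2] le1]; split=> //=; exact: leq_add.
Qed.

Lemma triple_conseq P Q c t (P' Q' : state -> Prop) t' :
  triple P' c t' Q' -> (forall s, P s -> P' s) -> (forall s, Q' s -> Q s) ->
  t' <= t -> triple P c t Q.
Proof.
move=> h PP' QQ' tt' s /PP'/h[/QQ' ? le_t]; split=> //; exact: leq_trans tt'.
Qed.

Lemma triple_ifzero P Q u c1 c2 t :
  triple (fun s => P s /\ get_cell s u = 0%R) c1 t Q ->
  triple (fun s => P s /\ get_cell s u = 1%R) c2 t Q ->
  triple P (IfZero u c1 c2) t.+1 Q.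
Proof.
move=> h1 h2 s Ps /=; have [u0|u1] := F2_cases (get_cell s u).
  by rewrite u0 eqxx; have [] := h1 s (conj Ps u0).
by rewrite u1 oner_eq0; have [] := h2 s (conj Ps u1).
Qed.

(** The counter is set before each run of the body, so the invariant has to survive any assignment
    to [x]. The bound charges one unit per iteration and one for the loop itself. *)
Lemma triple_for P x y c m t (Inv : nat -> state -> Prop) :
  (forall s, P s -> reg s y = m /\ Inv 0 s) ->
  (forall k v s, Inv k s -> Inv k (set_reg s x v)) ->
  (forall k, k < m -> triple (fun s => Inv k s /\ reg s x = k) c t (Inv k.+1)) ->
  triple P (For x y c) (m * t.+1).+1 (Inv m).
Proof.
move=> P0 Ireg Istep s /P0[ym I0] /=; rewrite ym.
elim: {-2}m (leqnn m) => [|k IH] km //=.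
have [Ik tk] := IH (ltnW km); set acc := iteri _ _ _ in Ik tk *.
have [|Ik1 tk1] := Istep k km (set_reg acc.1 x k); last by split=> //; lia.
by split; [exact: Ireg | rewrite /= eqxx].
Qed.

(** The counter [x] is left unspecified, since a loop changes it. *)
Definition row_updated (s s' : state) (x a i m : nat) (f : nat -> 'F_2) :=
  (forall r : nat, r != x -> reg s' r = reg s r) /\
  (forall a' i' j' : nat, Defs.mem s' a' i' j' =
     if [&& a' == a, i' == i & j' < m] then f j' else Defs.mem s a' i' j').

(** At column k the body may assume that only columns below k of the target row have changed; hence
    in-place updates can be described by an [f] computed from the initial state. *)
Lemma exec_row_loop (x y a r : nat) f c s :
  r != x ->
  (forall k s', k < reg s y -> row_updated s s' x a (reg s r) k f ->
     reg s' x = k -> exec c s' = (set_cell s' (Cell a r x) (f k), 1)) ->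
  row_updated s (exec (For x y c) s).1 x a (reg s r) (reg s y) f /\
  (exec (For x y c) s).2 <= (reg s y * 2).+1.
Proof.
move=> rx step.
apply: (@triple_for (eq s) x y c (reg s y) 1
         (fun k s' => row_updated s s' x a (reg s r) k f)) => //.
- move=> _ <-; split=> //; split=> // a' i' j'.
  by rewrite ltn0 !andbF.
- move=> k v s' [sreg smem]; split=> // z zx /=.
  by rewrite (negbTE zx) sreg.
move=> k km s' [rs' xk]; rewrite (step k) //; case: rs' => sreg smem.
split=> //; split=> //= a' i' j'; rewrite smem sreg // xk (leq_eqVlt j'.+1 k.+1) eqSS ltnS.
case: (a' == a); case: (i' == _) => //=.
by case: eqVneq => [->|].
Qed.

(** * The elimination program *)

(* Register 0 holds n, register 1 holds n + 1, registers 2 and 3 the indices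
   (i, j) of the current equation, registers 4 and 5 column indices, and
   register 6 always 0.  Row 0 of array 3 is the current equation and row p of
   array 4 the basis equation with pivot p. *)
Definition elim_step : cmd :=
  IfZero (Cell 3 6 5) Skip
    (Seq (IfZero (Cell 4 5 5)
            (* x * x = x in F_2: this copies row 0 of array 3 *)
            (For 4 1 (FMul (Cell 4 5 4) (Cell 3 6 4) (Cell 3 6 4))) Skip)
         (For 4 1 (FAdd (Cell 3 6 4) (Cell 3 6 4) (Cell 4 5 4)))).

Definition load_equation : cmd :=
  Seq (For 4 0 (FMul (Cell 3 6 4) (Cell 1 2 4) (Cell 0 4 3)))
      (FAdd (Cell 3 6 0) (Cell 0 2 3) (Cell 1 2 3)).

Definition process_equation : cmd :=
  Seq load_equation
      (Seq (For 5 0 elim_step)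
           (IfZero (Cell 3 6 0) Skip (FConst (Cell 2 6 6) 0%R))).

Definition init : cmd :=
  Seq (Seq (ICopy 1 0) (IIncr 1))
      (Seq (FConst (Cell 2 6 6) 1%R)
           (For 2 0 (Seq (FConst (Cell 0 2 2) 1%R) (FConst (Cell 1 2 2) 1%R)))).

Definition solver : cmd :=
  Seq init (For 2 0 (For 3 0 process_equation)).

(** * Correctness and running time of the elimination *)

Section Solver.
Variables (n : nat) (M M' : nat -> nat -> 'F_2).
Local Notation mem := Defs.mem.
Implicit Types (s : state) (S : (nat -> 'F_2) -> Prop).

Definition ready s : Prop :=
  [/\ reg s 0 = n, reg s 1 = n.+1, reg s 6 = 0 &
      forall i k, i < n -> k < n -> mem s 0 i k = M i k /\ mem s 1 i k = M' i k].

(** The output flag counts as one more condition: clearing it makes the solution set empty, which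
    records an inconsistency. *)
Definition solution s (d : nat -> 'F_2) : Prop :=
  mem s 2 0 0 = 1%R /\ forall p, p < n -> satisfies n (mem s 4 p) d.

(** Loop invariant of the reduction: [S] is the solution set to be preserved, and the current
    equation is cleared in the columns before [p]. *)
Definition reduced S p s : Prop :=
  [/\ echelon n (mem s 4), forall q, q < p -> mem s 3 0 q = 0%R &
      forall d, S d <-> solution s d /\ satisfies n (mem s 3 0) d].

Lemma ready_row_updated s s' x a i m f :
  ready s -> row_updated s s' x a i m f -> 1 < a -> x \in [:: 4; 5] -> ready s'.
Proof.
move=> [r0 r1 r6 mM] [rg mm] a1 x45.
have rgE r : r \in [:: 0; 1; 6] -> reg s' r = reg s r.
  rewrite !inE => r016; apply: rg.
  by move: x45 r016; rewrite !inE => /orP[] /eqP->; case/or3P=> /eqP->.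
split; rewrite ?rgE //.
by move=> i' k lti ltk; rewrite !mm; case: a a1 {mm} => [|[|a]] //= _; apply: mM.
Qed.

(** Slot p is free, and the current equation has its leading 1 at p, so the copy keeps the basis in
    echelon form. It duplicates an equation already imposed, so solutions are unchanged. *)
Lemma triple_copy S i p :
  p < n ->
  triple (fun s => ((ready s /\ reg s 2 = i /\ reduced S p s) /\ reg s 5 = p /\
                    mem s 3 0 p = 1%R) /\ get_cell s (Cell 4 5 5) = 0%R)
    (For 4 1 (FMul (Cell 4 5 4) (Cell 3 6 4) (Cell 3 6 4))) (2 * n + 3)
    (fun s => (ready s /\ reg s 2 = i /\ reduced S p s) /\ reg s 5 = p /\
              mem s 3 0 p = 1%R /\ mem s 4 p p = 1%R).
Proof.
move=> pn s [[[rd [r2 [ech v0 eS]]] [r5 vp]]].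
rewrite /get_cell /= r5 => Bpp.
have [_ r1 r6 _] := rd.
have [|] := @exec_row_loop 4 1 4 5 (mem s 3 0)
      (FMul (Cell 4 5 4) (Cell 3 6 4) (Cell 3 6 4)) s isT.
  move=> k s' km [rg mm] r4; rewrite /= /get_cell /= r4 rg // r6 mm /=.
  by rewrite mulrr_F2.
set s' := (exec _ s).1 => upd tm; split; last by apply: leq_trans tm _; rewrite r1; lia.
have rd' := ready_row_updated rd upd isT isT.
case: upd => rg mm; rewrite r1 r5 in mm.
have v' q : mem s' 3 0 q = mem s 3 0 q by rewrite mm.
have Bp q : q <= n -> mem s' 4 p q = mem s 3 0 q by move=> qn; rewrite mm !eqxx ltnS qn.
have Bq q k : q != p -> mem s' 4 q k = mem s 4 q k.
  by move=> /negbTE qp; rewrite mm qp.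
split; last by rewrite rg // v' Bp // ltnW.
split=> //; split; first by rewrite rg.
(* A basis row with diagonal entry 0 cannot have its pivot there, so it vanishes entirely. *)
have Bp0 q : q <= n -> mem s 4 p q = 0%R.
  by have [[]|] := ech p pn; [rewrite Bpp | apply].
split.
- move=> q qn; have [->|qp] := eqVneq q p.
    by left; split=> [|k kp]; rewrite Bp ?(v0 k kp) //; lia.
  have [[B1 B0]|B0] := ech q qn; [left; split=> [|k kq]|right=> k kn];
  by rewrite Bq // B0.
- by move=> q qp; rewrite v' v0.
move=> d; rewrite eS /solution mm /=; rewrite (@eq_satisfies n (mem s' 3 0) (mem s 3 0)) //.
split=> [[[out sB] sv]|[[out sB] sv]]; split=> //; split=> // q qn.
  have [->|qp] := eqVneq q p; first by rewrite (eq_satisfies d Bp).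
  by rewrite (@eq_satisfies _ _ (mem s 4 q)); [apply: sB | move=> k _; rewrite Bq].
have [->|qp] := eqVneq q p; first exact: satisfies0.
by rewrite -(@eq_satisfies _ (mem s' 4 q)); [apply: sB | move=> k _; rewrite Bq].
Qed.

(** Basis row p begins with its 1 at p, so adding it clears entry p and keeps the earlier zeros;
    since that row is itself imposed, solutions are unchanged. Right after a copy the current
    equation becomes zero. *)
Lemma triple_reduce S i p :
  p < n ->
  triple (fun s => (ready s /\ reg s 2 = i /\ reduced S p s) /\ reg s 5 = p /\
              mem s 3 0 p = 1%R /\ mem s 4 p p = 1%R)
    (For 4 1 (FAdd (Cell 3 6 4) (Cell 3 6 4) (Cell 4 5 4))) (2 * n + 3)
    (fun s => ready s /\ reg s 2 = i /\ reduced S p.+1 s).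
Proof.
move=> pn s [[rd [r2 [ech v0 eS]]] [r5 [vp Bpp]]].
have [_ r1 r6 _] := rd.
have [|] := @exec_row_loop 4 1 3 6 (fun q => mem s 3 0 q + mem s 4 p q)%R
      (FAdd (Cell 3 6 4) (Cell 3 6 4) (Cell 4 5 4)) s isT.
  move=> k s' km [rg mm] r4; rewrite /= /get_cell /= r4 !rg // r6 r5 !mm /=.
  by rewrite ltnn andbF.
set s' := (exec _ s).1 => upd tm; split; last by apply: leq_trans tm _; rewrite r1; lia.
have rd' := ready_row_updated rd upd isT isT.
case: upd => rg mm; rewrite r1 r6 in mm.
split=> //; split; first by rewrite rg.
have v' q : q <= n -> mem s' 3 0 q = (mem s 3 0 q + mem s 4 p q)%R.
  by move=> qn; rewrite mm ltnS qn.
have B' q k : mem s' 4 q k = mem s 4 q k by rewrite mm.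
split.
- move=> q qn; have [[B1 B0]|B0] := ech q qn; [left; split=> [|k kq]|right=> k kn];
  by rewrite B' // B0.
- move=> q; rewrite ltnS leq_eqVlt => /orP[/eqP->|qp].
    by rewrite v' ?vp ?Bpp ?addrr_F2 // ltnW.
  rewrite v' ?v0 //; last by lia.
  by have [[_ ->]|->] := ech p pn; rewrite ?addr0 //; lia.
move=> d; rewrite eS /solution mm /=.
have sBE q : satisfies n (mem s' 4 q) d <-> satisfies n (mem s 4 q) d by apply: eq_satisfies.
split=> [[[out sB] sv]|[[out sB] sv]].
  have sB' q : q < n -> satisfies n (mem s' 4 q) d by move=> qn; apply/sBE/sB.
  by split=> //; apply/(satisfies_add v' (sB p pn)).
have sB' q : q < n -> satisfies n (mem s 4 q) d by move=> qn; apply/sBE/sB.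
by split=> //; apply/(satisfies_add v' (sB' p pn)).
Qed.

Lemma triple_elim_step S i p :
  p < n ->
  triple (fun s => (ready s /\ reg s 2 = i /\ reduced S p s) /\ reg s 5 = p)
    elim_step (4 * n + 8)
    (fun s => ready s /\ reg s 2 = i /\ reduced S p.+1 s).
Proof.
move=> pn; rewrite [4 * n + 8](_ : _ = (4 * n + 7).+1); last by lia.
apply: triple_ifzero.
  apply: (triple_conseq (@triple_skip _) _ (fun s => id)); last by lia.
  move=> s [[[rd [r2 [ech v0 eS]]] r5] vp]; split=> //; split=> //; split=> //.
  move: vp; case: rd => _ _ r6 _; rewrite /get_cell /= r5 r6 => vp q.
  by rewrite ltnS leq_eqVlt => /orP[/eqP->|/v0].
rewrite [4 * n + 7](_ : _ = (2 * n + 3).+1 + (2 * n + 3)); last by lia.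
apply: triple_seq _ (triple_reduce pn).
apply: triple_ifzero.
  apply: (triple_conseq (triple_copy (S := S) (i := i) pn) _ (fun s => id)) => //.
  move=> s [[[h r5] vp] Bp]; split=> //; split=> //; split=> //.
  by case: h => [[_ _ r6 _] _]; move: vp; rewrite /get_cell /= r5 r6.
apply: (triple_conseq (@triple_skip _) _ (fun s => id)); last by lia.
move=> s [[[h r5] vp] Bp]; split=> //; split=> //.
by case: h => [[_ _ r6 _] _]; move: vp Bp; rewrite /get_cell /= r5 r6.
Qed.

Definition equation i j k : 'F_2 :=
  if k < n then (M' i k * M k j)%R else (M i j + M' i j)%R.

Definition basis S s : Prop :=
  echelon n (mem s 4) /\ forall d, S d <-> solution s d.

Lemma triple_load_equation S i j :
  i < n -> j < n ->
  triple (fun s => ready s /\ reg s 2 = i /\ reg s 3 = j /\ basis S s)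
    load_equation (2 * n + 2)
    (fun s => ready s /\ reg s 2 = i /\
              reduced (fun d => S d /\ satisfies n (equation i j) d) 0 s).
Proof.
move=> ltin ltjn s [rd [r2 [r3 [ech eS]]]].
have [r0 _ r6 mM] := rd.
have [|] := @exec_row_loop 4 0 3 6 (equation i j)
      (FMul (Cell 3 6 4) (Cell 1 2 4) (Cell 0 4 3)) s isT.
  move=> k s' km [rg mm] r4; rewrite /= /get_cell /= r4 !rg // r2 r3 !mm /=.
  rewrite r0 in km.
  by rewrite /equation km (proj1 (mM _ _ km ltjn)) (proj2 (mM _ _ ltin km)).
rewrite /load_equation; set c := For _ _ _; rewrite [exec (Seq _ _) s]/=.
set s1 := (exec c s).1 => upd tm.
split; last by rewrite /= addn1 addn2 ltnS; apply: leq_trans tm _; rewrite r0; lia.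
have rd' := ready_row_updated rd upd isT isT.
case: upd => rg mm; rewrite r0 r6 in mm.
split; first by case: rd'.
split; first by rewrite /= rg.
split=> //=; first by move=> q qn; have [[B1 B0]|B0] := ech q qn;
  [left; split=> [|k kq]|right=> k kn]; rewrite mm // B0.
move=> d; rewrite eS /solution /= !mm /=.
rewrite (_ : satisfies n _ d <-> satisfies n (equation i j) d); last first.
  apply: eq_satisfies => q qn; rewrite /get_cell /= !rg // r0 r2 r3 r6.
  (* Column n, addressed by register 0, is written by the final addition; the loop fills the columns
     below n. *)
  rewrite !mm /= /equation; have [->|qn'] := eqVneq q n.
    by rewrite ltnn (proj1 (mM _ _ ltin ltjn)) (proj2 (mM _ _ ltin ltjn)).
  by rewrite (_ : q < n) //; lia.
have sBE q : satisfies n (mem s1 4 q) d <-> satisfies n (mem s 4 q) d.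
  by apply: eq_satisfies => k _; rewrite mm.
by split=> [[[out sB] ?]|[[out sB] ?]]; split=> //; split=> // q /sB /sBE.
Qed.

Lemma triple_process_equation S i j :
  i < n -> j < n ->
  triple (fun s => ready s /\ reg s 2 = i /\ reg s 3 = j /\ basis S s)
    process_equation (4 * n ^ 2 + 11 * n + 5)
    (fun s => ready s /\ reg s 2 = i /\
              basis (fun d => S d /\ satisfies n (equation i j) d) s).
Proof.
move=> ltin ltjn.
rewrite (_ : 4 * n ^ 2 + 11 * n + 5 =
             (2 * n + 2) + ((n * (4 * n + 8).+1).+1 + 2)); last by lia.
apply: triple_seq (triple_load_equation ltin ltjn) _.
apply: triple_seq.
  apply: (@triple_for _ 5 0 elim_step n _ (fun p s => ready s /\ reg s 2 = i /\
            reduced (fun d => S d /\ satisfies n (equation i j) d) p s)) => //.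
  - by move=> s [[r0 ? ? ?] h].
  by move=> p pn; exact: triple_elim_step pn.
(* After n reductions only the right-hand side can be nonzero: the equation is either 0 = 0, which
   is dropped, or 0 = 1, which clears the flag. *)
apply: triple_ifzero => s [[rd [r2 [ech v0 eS]]]];
  have [r0 _ r6 _] := rd; rewrite /get_cell /= r0 r6 => vn; split=> //.
  split=> //; split=> //; split=> // d; rewrite eS; split=> [[]|] // sd.
  split=> //; apply: satisfies0 => q; rewrite leq_eqVlt => /orP[/eqP->//|]; exact: v0.
split=> //; split=> //; split=> // d; rewrite eS /solution /= r6 eqxx /=.
by split=> [[_ /(not_satisfies v0 vn)]|[/eqP]].
Qed.

(** The pairs before (i, j) in lexicographic order, as traversed by the two nested loops. *)
Definition processed i j (d : nat -> 'F_2) : Prop :=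
  forall i' j', i' < n -> j' < n -> (i' < i) || ((i' == i) && (j' < j)) ->
    satisfies n (equation i' j') d.

Lemma triple_all_equations :
  triple (fun s => ready s /\ basis (fun=> True) s)
    (For 2 0 (For 3 0 process_equation))
    (n * (n * (4 * n ^ 2 + 11 * n + 5).+1).+2).+1
    (fun s => basis (fun d => forall i j, i < n -> j < n ->
                                satisfies n (equation i j) d) s).
Proof.
have basis_ext S S' s : (forall d, S d <-> S' d) -> basis S s -> basis S' s.
  by move=> SS' [ech eS]; split=> // d; rewrite -SS'.
pose Inv i s := ready s /\ basis (processed i 0) s.
apply: (@triple_conseq _ _ _ _ (fun s => ready s /\ basis (fun=> True) s)
         (Inv n) _) (leqnn _) => //; last first.
  move=> s [_]; apply: basis_ext => d.
  by split=> [h i j ltin ltjn|h i j ltin ltjn _]; apply: h; rewrite ?ltin.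
apply: triple_for => //.
- move=> s [rd ba]; split; first by case: rd.
  by split=> //; apply: basis_ext ba => d; split=> // _ i j _ _; rewrite andbF.
move=> i ltin.
pose Inv' j s := ready s /\ reg s 2 = i /\ basis (processed i j) s.
apply: (@triple_conseq _ _ _ _ (fun s => Inv i s /\ reg s 2 = i)
         (Inv' n) _) (leqnn _) => //; last first.
  move=> s [rd [_ ba]]; split=> //; apply: basis_ext ba => d.
  split=> h i' j' lti' ltj' hij; apply: h => //; lia.
apply: triple_for => //.
- by move=> s [[rd ba] r2]; split; first by case: rd.
move=> j ltjn.
apply: (triple_conseq (triple_process_equation (S := processed i j) ltin ltjn)) => //.
  by move=> s [[rd [r2 ba]] r3].
move=> s [rd [r2 ba]]; split=> //; split=> //; apply: basis_ext ba => d.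
split=> [[h hij] i' j' lti' ltj' lt|h].
  have [/andP[/eqP-> /eqP->]//|ne] := boolP ((i' == i) && (j' == j)).
  by apply: h => //; lia.
by split=> [i' j' lti' ltj' lt|]; apply: h => //; lia.
Qed.

End Solver.

(** * From the input arrays to the matrix equation *)

Local Open Scope ring_scope.

Lemma mx_array_ord n (M : 'M['F_2]_n) (i j : 'I_n) : mx_array M i j = M i j.
Proof. by rewrite /mx_array !valK. Qed.

Local Notation array_of G := (mx_array (loopmx G)).

Lemma array_of_loopmx n (G : graph n) i k :
  (i < n)%N -> (k < n)%N ->
  array_of G i k = if i == k then 1 else mx_array (adjmx G) i k.
Proof.
move=> ltin ltkn; rewrite -[i]/(val (Ordinal ltin)) -[k]/(val (Ordinal ltkn)).
rewrite !mx_array_ord loopmxE mxE -val_eqE /=.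
case: eqP => [eik|]; last by rewrite addbF.
rewrite (_ : Ordinal ltkn = Ordinal ltin) ?adjii //; exact: val_inj.
Qed.

Lemma triple_init n (G G' : graph n) :
  triple (fun s => s = input_state G G') init (3 * n + 4)
    (fun s => ready n (array_of G) (array_of G') s /\ basis n (fun=> True) s).
Proof.
(* The first [m] diagonal entries have been set to 1, turning Gamma into Gamma + I. *)
pose diag_set (H : graph n) m (A : nat -> nat -> 'F_2) :=
  forall i k, A i k =
    if (i == k) && (i < m)%N then 1 else mx_array (adjmx H) i k.
pose Inv m s := [/\ reg s 0 = n, reg s 1 = n.+1 & reg s 6 = 0]%N /\
  [/\ diag_set G m (Defs.mem s 0), diag_set G' m (Defs.mem s 1),
      Defs.mem s 2 0 0 = 1 & forall p q, Defs.mem s 4 p q = 0].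
rewrite (_ : 3 * n + 4 = (1 + 1) + (1 + (n * 3).+1))%N; last by lia.
apply: (@triple_seq (fun s => [/\ reg s 0 = n, reg s 1 = n.+1, reg s 6 = 0%N
                          & Defs.mem s = Defs.mem (input_state G G')])).
  by move=> _ ->; split=> //; split.
apply: (@triple_seq (Inv 0%N)).
  move=> s [r0 r1 r6 ms]; split=> //; split=> //=; rewrite ms.
  split=> [i k|i k||p q] //=; last by rewrite r6.
  - by rewrite ltn0 andbF.
  - by rewrite ltn0 andbF.
apply: (@triple_conseq _ _ _ _ (Inv 0%N) (Inv n) _) (leqnn _) => //; last first.
  move=> s [[r0 r1 r6] [m0 m1 m2 m4]]; split.
    by split=> // i k ltin ltkn; rewrite m0 m1 !array_of_loopmx // ltin andbT.
  split=> [p pn|d]; first by right=> q _.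
  by split=> // _; split=> // p pn; apply: satisfies0.
apply: triple_for => [s [[]]//|//|m mn s [[[r0 r1 r6] [m0 m1 m2 m4]] r2]].
split=> //; split=> //; split=> //= i k;
  rewrite r2 ?m0 ?m1 (ltnS i m) (leq_eqVlt i m) (eq_sym k);
  by case: (eqVneq i m) => [->|_] //=; case: eqP.
Qed.

Lemma satisfies_equation n (G G' : graph n) (d : nat -> 'F_2) :
  (forall i j, (i < n)%N -> (j < n)%N ->
     satisfies n (equation n (array_of G) (array_of G') i j) d) <->
  pivot_eq G G' (\row_k d k).
Proof.
rewrite pivot_eq_system.
have eqE (i j : 'I_n) :
    satisfies n (equation n (array_of G) (array_of G') i j) d <->
    \sum_(k < n) (loopmx G' i k * loopmx G k j) * (\row_k d k) 0 k =
    adjmx G i j + adjmx G' i j.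
  rewrite /satisfies /equation ltnn !mx_array_ord.
  (* The two identity matrices cancel. *)
  have -> : loopmx G i j + loopmx G' i j = adjmx G i j + adjmx G' i j.
    by rewrite !mxE addrACA addrr_F2 addr0.
  rewrite (eq_bigr (fun k : 'I_n =>
     (loopmx G' i k * loopmx G k j) * (\row_k d k) 0 k)) // => k _.
  by rewrite ltn_ord !mx_array_ord [in RHS]mxE.
split=> [h i j|h i j ltin ltjn]; first by apply/eqE/h.
exact/(eqE (Ordinal ltin) (Ordinal ltjn)).
Qed.

Lemma triple_solver n (G G' : graph n) :
  triple (fun s => s = input_state G G') solver
    (3 * n + 4 + (n * (n * (4 * n ^ 2 + 11 * n + 5).+1).+2).+1)
    (fun s => Defs.mem s 2 0 0 = 1 <-> edge_locally_equivalent G G').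
Proof.
have h := triple_seq (@triple_init n G G') (@triple_all_equations n _ _).
apply: (triple_conseq h) => //.
move=> s [ech solP]; rewrite edge_locally_equivalentP; split=> [out|[d ed]].
  (* An echelon basis is always solvable, so a flag equal to 1 already yields a solution of the
     whole system. *)
  have [d dP] := echelon_solvable ech.
  by exists (\row_k d k); apply/satisfies_equation/solP.
pose d' k : 'F_2 := if insub k is Some k' then d 0 k' else 0.
have ed' : pivot_eq G G' (\row_k d' k).
  by rewrite (_ : \row_k _ = d) //; apply/rowP=> k; rewrite mxE /d' valK.
by have [] := (solP d').1 ((satisfies_equation _ _ _).2 ed').
Qed.

Theorem mainTheorem2 :
  (forall (n : nat) (G G' : graph n),
     edge_locally_equivalent G G' <->
     exists A : 'M['F_2]_n,
       is_diag_mx A /\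
       (adjmx G' + 1%:M) *m A *m (adjmx G + 1%:M) = adjmx G + adjmx G') /\
  (forall (n : nat) (G G' : graph n) (d : 'rV['F_2]_n),
     (adjmx G' + 1%:M) *m diag_mx d *m (adjmx G + 1%:M) = adjmx G + adjmx G' <->
     forall i j : 'I_n,
       \sum_(k < n) ((adjmx G' + 1%:M) i k * (adjmx G + 1%:M) k j) * d 0 k =
       adjmx G i j + adjmx G' i j) /\
  decidable_in_time edge_locally_equivalent (fun n => n ^ 4)%N.
Proof.
split=> [n G G'|].
  rewrite edge_locally_equivalentP.
  split=> [[d ed]|[A [/diag_mxP[d ->] ed]]]; last by exists d.
  by exists (diag_mx d); split=> //; apply: diag_mx_is_diag.
split; first exact: pivot_eq_system.
exists solver; split=> [n G G'|].
  rewrite /accepts; have [<- _] := @triple_solver n G G' _ erefl.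
  by split=> [/eqP|->].
(* 31 = 4 + 11 + 6 + 5 + 5 is the sum of the coefficients of the bound, and each power of n up to
   the fourth is at most [n ^ 4] once n is positive. *)
exists 31, 1 => n G G' n_gt0; have [_ /leq_trans->//] := @triple_solver n G G' _ erefl.
rewrite (_ : _ + _ = 4 * n ^ 4 + 11 * n ^ 3 + 6 * n ^ 2 + 5 * n + 5)%N; last by lia.
have n4 k : (k <= 4 -> n ^ k <= n ^ 4)%N by move=> k4; rewrite leq_pexp2l.
by have := n4 0%N isT; have := n4 1%N isT; have := n4 2%N isT; have := n4 3%N isT; rewrite expn0 expn1 /=; lia.
Qed.
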